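(* Let $n\ge 1$ be an integer and let $q\in\mathbb{C}$, $q\neq 0$, be such that $q^j\neq 1$ for all $j=1,2,\dots,n-1$. Then the following hold for the $n\times n$ matrices $T_q$, $T_{q^{-1}}$, $S$, $D_q$ and the identity matrix $I$. (i) $(T_q)^{-1}=T_{q^{-1}}(I-S)=D_{q^{-1}}\,T_{q^{-1}}\,D_q$. (ii) For every integer $m\ge 1$, $$T_q\, D_{q^{-m}}\, T_{q^{-1}}\, D_{q^m}=I+\sum_{j=1}^{m-1}\frac{(q^{1-m};q)_j}{(q;q)_j}\,S^j,$$ where terms with $j\ge n$ are understood to be zero (since $S^j=0$ for $j\ge n$).
   Context: All matrices are $n\times n$ with complex entries, with rows and columns indexed by $0,1,\dots,n-1$, and $I$ is the $n\times n$ identity matrix. The $q$-Pochhammer symbol is $(z;q)_0:=1$ and $(z;q)_k:=(1-z)(1-zq)\cdots(1-zq^{k-1})$ for $k\ge 1$. For a complex number $p$ with $p^j\ne 1$ for $j=1,\dots,n-1$, $T_p=\{t_{i,j}\}_{0\le i,j\le n-1}$ is the lower-triangular Toeplitz matrix with $t_{i,j}=1/(p;p)_{i-j}$ if $i\ge j$ and $t_{i,j}=0$ if $i<j$. This is used with $p=q$ and $p=q^{-1}$. $S$ is the matrix with entries equal to $1$ on the first sub-diagonal (positions $(i,j)$ with $i=j+1$) and $0$ elsewhere. For a complex number $p$, $D_p$ is the diagonal matrix with entries $1,p,p^2,\dots,p^{n-1}$ on the main diagonal. This is used with $p=q,\ q^{-1},\ q^{m},\ q^{-m}$. *)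

(* Defs.v *)
From mathcomp Require Import all_boot all_order all_algebra.
Set Implicit Arguments.
Unset Strict Implicit.
Unset Printing Implicit Defensive.
Import Order.TTheory GRing.Theory Num.Theory.
Local Open Scope ring_scope.

Definition qpoch (F : fieldType) (z q : F) (k : nat) : F :=
  \prod_(i < k) (1 - z * q ^+ i).

(* Intended for [p] with [p ^+ j != 1] for [0 < j < n]: then no denominator
   [qpoch p p (i - j)] vanishes. *)
Definition toepT (F : fieldType) (n : nat) (p : F) : 'M[F]_n :=
  \matrix_(i, j) if (j <= i)%N then (qpoch p p (i - j))^-1 else 0.

Definition shiftS (F : fieldType) (n : nat) : 'M[F]_n :=
  \matrix_(i, j) (i == j.+1 :> nat)%:R.

Definition diagD (F : fieldType) (n : nat) (p : F) : 'M[F]_n :=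
  diag_mx (\row_i p ^+ i).

(* Main.v *)
Require Import Defs.
From mathcomp Require Import all_boot all_order all_algebra.
From mathcomp Require Import reals complex ring.
Set Implicit Arguments.
Unset Strict Implicit.
Unset Printing Implicit Defensive.
Import Order.TTheory GRing.Theory Num.Theory.
Local Open Scope ring_scope.

(** Lower-triangular Toeplitz matrices multiply by convolving their coefficient
    sequences, and conjugating one by the diagonal matrix of the powers of [p]
    rescales its [k]-th coefficient by [p ^- k].  The diagonal matrices
    occur only in such conjugations and all other matrices are Toeplitz, so each
    identity reduces to one between sequences.

    The identity behind (ii) is the finite [q]-binomial theorem
      [\sum_(i + j = k) 1/(q;q)_i * z^j/(q^-1;q^-1)_j = (zq;q)_k / (q;q)_k],
    taken at [z = q ^- m] ([qbinomial_conv]).  It follows from the first-order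
    recurrence [c_k (1 - q^k) = c_(k-1) (1 - z q^k)], obtained by splitting
    [1 - q^(i+j)] as [(1 - q^i) + q^i (1 - q^j)]: each part cancels the last
    factor of one of the two denominators.  At [z = q ^- m] the right-hand side
    vanishes for [k >= m], which is why the sum in (ii) stops at [m - 1].

    In (i), the second equality is the relation
    [1/(p;p)_k - 1/(p;p)_(k-1) = p^k/(p;p)_k] at [p = q^-1], and invertibility
    together with the value of the inverse is the case [m = 1] of (ii), where the
    sum is empty. *)

(** * The q-Pochhammer symbol and the finite q-binomial theorem *)

Section QPochhammer.
Variable F : fieldType.
Implicit Types p q z : F.

Lemma qpoch0 z q : qpoch z q 0 = 1.
Proof. by rewrite /qpoch big_ord0. Qed.

Lemma qpochS z q k : qpoch z q k.+1 = qpoch z q k * (1 - z * q ^+ k).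
Proof. by rewrite /qpoch big_ord_recr. Qed.

Lemma qpoch_eq0 z q k j : (j < k)%N -> z * q ^+ j = 1 -> qpoch z q k = 0.
Proof.
move=> jk zq1; apply/eqP/prodf_eq0.
by exists (Ordinal jk); rewrite //= zq1 subrr.
Qed.

Lemma qpoch_inv_rec p k : p ^+ k.+1 != 1 ->
  (qpoch p p k.+1)^-1 * (1 - p ^+ k.+1) = (qpoch p p k)^-1.
Proof.
by move=> pk; rewrite qpochS -exprS invfM mulfVK // subr_eq0 eq_sym.
Qed.

Lemma expr_inv_neq1 q j : q ^+ j != 1 -> q^-1 ^+ j != 1.
Proof. by rewrite exprVn invr_eq1. Qed.

Definition conv (a b : nat -> F) (k : nat) : F :=
  \sum_(l < k.+1) a (k - l)%N * b l.

(** The ratio of consecutive terms of the [q]-binomial convolution: the factor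
    [1 - q ^+ k.+1] splits along [k.+1 = (k.+1 - l) + l], and each of the two
    sums it produces is, after a shift of index, a multiple of the convolution
    at [k]. *)
Lemma qbinomial_conv_rec q z k : q != 0 ->
    (forall j, (0 < j <= k.+1)%N -> q ^+ j != 1) ->
  let c := conv (fun i => (qpoch q q i)^-1)
                (fun j => (qpoch q^-1 q^-1 j)^-1 * z ^+ j) in
  c k.+1 * (1 - q ^+ k.+1) = c k * (1 - z * q ^+ k.+1).
Proof.
move=> q0 hq /=; set e := fun i => (qpoch q q i)^-1.
set f := fun j => (qpoch q^-1 q^-1 j)^-1 * z ^+ j.
have eS i : (i <= k)%N -> e i.+1 * (1 - q ^+ i.+1) = e i.
  by move=> ik; apply: qpoch_inv_rec; apply: hq.
have fS j : (j <= k)%N -> f j.+1 * (1 - q ^+ j.+1) = - (z * q ^+ j.+1) * f j.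
  move=> jk; rewrite /f -(@qpoch_inv_rec q^-1 j); last first.
    by apply: expr_inv_neq1; apply: hq.
  (* 1 - q^j = - q^j (1 - q^-j) *)
  have -> : 1 - q ^+ j.+1 = - q ^+ j.+1 * (1 - q^-1 ^+ j.+1).
    by rewrite exprVn mulrBr mulr1 mulNr mulfV ?expf_neq0 // opprK addrC.
  by rewrite [z ^+ _]exprS; ring.
rewrite /conv mulr_suml.
transitivity (\sum_(l < k.+2) e (k.+1 - l)%N * (1 - q ^+ (k.+1 - l)) * f l
   + \sum_(l < k.+2) q ^+ (k.+1 - l) * e (k.+1 - l)%N * (f l * (1 - q ^+ l))).
  rewrite -big_split; apply: eq_bigr => l _ /=.
  have -> : 1 - q ^+ k.+1 =
      (1 - q ^+ (k.+1 - l)) + q ^+ (k.+1 - l) * (1 - q ^+ l).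
    by rewrite mulrBr mulr1 -exprD subnK -1?ltnS // addrA subrK.
  rewrite mulrDr; congr (_ + _); first by rewrite mulrAC.
  by rewrite mulrCA !mulrA.
rewrite big_ord_recr /= subnn expr0 subrr mulr0 mul0r addr0.
rewrite [X in _ + X]big_ord_recl /= expr0 subrr !mulr0 add0r.
(* the terms e 0 (1 - q^0) and f 0 (1 - q^0) are gone, so both sums now range
   over l <= k *)
rewrite mulrBr mulr1 mulr_suml -sumrN -!big_split; apply: eq_bigr => l _ /=.
have lk : (l <= k)%N by rewrite -ltnS.
rewrite subSn // eS ?leq_subr // /bump /= add1n subSS fS //.
rewrite !mulNr !mulrN; congr (_ - _).
have -> : q ^+ k.+1 = q ^+ (k - l) * q ^+ l.+1 by rewrite -exprD addnS subnK.
by ring.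
Qed.

(** The finite [q]-binomial theorem; rewriting [(q^-1;q^-1)_j] as
    [(-1)^j q^(-j(j+1)/2) (q;q)_j] gives its usual form. *)
Lemma qbinomial_conv q z k : q != 0 ->
    (forall j, (0 < j <= k)%N -> q ^+ j != 1) ->
  conv (fun i => (qpoch q q i)^-1)
       (fun j => (qpoch q^-1 q^-1 j)^-1 * z ^+ j) k
    = qpoch (z * q) q k / qpoch q q k.
Proof.
move=> q0; elim: k => [|k IHk] hq.
  by rewrite /conv big_ord_recl big_ord0 /= !qpoch0 !invr1 !mulr1 addr0.
have qk : 1 - q ^+ k.+1 != 0 by rewrite subr_eq0 eq_sym hq /= ?leqnn.
apply: (mulIf qk); rewrite qbinomial_conv_rec // IHk; last first.
  by move=> j /andP[j0 jk]; rewrite hq // j0 ltnW.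
rewrite -(@qpoch_inv_rec q k) ?hq ?leqnn //.
by rewrite [qpoch (z * q) _ k.+1]qpochS -[z * q * _]mulrA -exprS; ring.
Qed.

End QPochhammer.

(** * Lower-triangular Toeplitz matrices *)

Section Toeplitz.
Variables (F : fieldType) (n : nat).
Implicit Types (a b : nat -> F) (p : F).

Definition toeplitz a : 'M[F]_n :=
  \matrix_(i, j) if (j <= i)%N then a (i - j)%N else 0.

Lemma eq_toeplitz a b : (forall k, (k < n)%N -> a k = b k) ->
  toeplitz a = toeplitz b.
Proof.
move=> ab; apply/matrixP=> i j; rewrite !mxE.
by case: ifP => // _; rewrite ab // (leq_ltn_trans (leq_subr _ _)).
Qed.

Lemma toeplitzM a b : toeplitz a *m toeplitz b = toeplitz (conv a b).
Proof.
apply/matrixP=> i j; rewrite !mxE.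
(* The k-th term of the entry (i, j) lives on j <= k <= i; shifting the range
   by j turns it into the convolution at i - j. *)
pose G k := if (j <= k <= i)%N then a (i - k)%N * b (k - j)%N else 0.
transitivity (\sum_(0 <= k < n) G k).
  rewrite big_mkord; apply: eq_bigr => k _; rewrite !mxE /G.
  by case: (leqP j k); case: (leqP k i); rewrite ?mulr0 ?mul0r.
case: leqP => [ji|ij]; last first.
  rewrite big1 // => k _; rewrite /G; case: ifP => // /andP[jk ki].
  by have := leq_trans jk ki; rewrite leqNgt ij.
rewrite (@big_cat_nat _ _ _ j) ?(ltnW (ltn_ord j)) //=.
rewrite [X in X + _]big1_seq ?add0r; last first.
  move=> k; rewrite mem_index_iota /G => /andP[_ /andP[_ kj]].
  by rewrite leqNgt kj.
rewrite (@big_cat_nat _ _ _ i.+1) ?ltn_ord //=; last exact: leqW.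
rewrite [X in _ + X]big1_seq ?addr0; last first.
  move=> k; rewrite mem_index_iota /G => /andP[_ /andP[ik _]].
  by rewrite [(k <= i)%N]leqNgt ik andbF.
rewrite -{1}[nat_of_ord j]add0n big_addn subSn // big_mkord.
apply: eq_bigr => l _; have lij : (l <= i - j)%N by rewrite -ltnS.
by rewrite /G leq_addl addnK [(l + j)%N]addnC -leq_subRL // lij subnDA.
Qed.

Lemma diagD_toeplitz p a : p != 0 ->
  diagD n p^-1 *m toeplitz a *m diagD n p = toeplitz (fun k => a k * p^-1 ^+ k).
Proof.
move=> p0; apply/matrixP=> i j; rewrite mul_mx_diag mul_diag_mx !mxE.
case: leqP => [ji|_]; last by rewrite mulr0 mul0r.
have -> : p^-1 ^+ i = p^-1 ^+ (i - j) * p^-1 ^+ j by rewrite -exprD subnK.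
by rewrite mulrAC -[_ * p ^+ j]mulrA -exprMn mulVf // expr1n mulr1 mulrC.
Qed.

(** The powers of [S] are the Toeplitz matrices of the Kronecker deltas, so a
    Toeplitz matrix is a polynomial in [S] with its own coefficients. *)
Lemma shiftS_exp k : shiftS F n ^+ k = toeplitz (fun l => (l == k)%:R).
Proof.
have S1 : shiftS F n = toeplitz (fun l => (l == 1%N)%:R).
  apply/matrixP=> i j; rewrite !mxE; case: leqP => [ji|ij].
    by rewrite -[(i - j == _)%N](eqn_add2r j) subnK.
  by rewrite ltn_eqF // leqW.
elim: k => [|k IHk].
  apply/matrixP=> i j; rewrite !mxE; case: leqP => [ji|ij].
    by rewrite -[(i - j == _)%N](eqn_add2r j) subnK // add0n.
  by rewrite -val_eqE /= ltn_eqF.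
rewrite exprSr IHk {1}S1; apply: etrans (toeplitzM _ _) _.
apply: eq_toeplitz => -[|l] _; rewrite /conv.
  by rewrite big_ord_recl big_ord0 /= mulr0 addr0.
rewrite 2!big_ord_recl big1 /=; last by move=> i _; rewrite mulr0.
by rewrite mulr0 add0r addr0 mulr1 subSS subn0 eqSS.
Qed.

Lemma toeplitz_sum a : toeplitz a = \sum_(0 <= k < n) a k *: shiftS F n ^+ k.
Proof.
apply/matrixP=> i j; rewrite big_mkord summxE.
under eq_bigr => k _ do rewrite shiftS_exp !mxE.
rewrite mxE; case: leqP => [ji|_]; last first.
  by rewrite big1 // => k _; rewrite mulr0.
have lt_n : (i - j < n)%N by rewrite (leq_ltn_trans (leq_subr _ _)).
rewrite (bigD1 (Ordinal lt_n)) //= eqxx mulr1 big1 ?addr0 // => k.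
by rewrite -val_eqE eq_sym /= => /negPf->; rewrite mulr0.
Qed.

(** The two cut-offs [j < m] and [j < n] agree on the nonzero terms. *)
Lemma toeplitz_sum_cut m a : (0 < m)%N -> (0 < n)%N -> a 0%N = 1 ->
    (forall k, (m <= k < n)%N -> a k = 0) ->
  toeplitz a = 1%:M + \sum_(1 <= j < m | (j < n)%N) a j *: shiftS F n ^+ j.
Proof.
move=> m0 n0 a0 am.
transitivity (\sum_(0 <= j < m | (j < n)%N) a j *: shiftS F n ^+ j); last first.
  by rewrite big_ltn_cond // n0 a0 scale1r expr0.
rewrite toeplitz_sum.
rewrite (big_nat_widen _ _ _ _ _ (leq_maxr m n)).
rewrite [RHS](big_nat_widen _ _ _ _ _ (leq_maxl m n)).
rewrite big_mkcond [RHS]big_mkcond; apply: eq_bigr => k _ /=.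
case: (ltnP k n) => //= kn; case: (ltnP k m) => // mk.
by rewrite am ?mk // scale0r.
Qed.

End Toeplitz.

(** * The matrices of reciprocal q-Pochhammer symbols *)

Section QToeplitz.
Variables (F : fieldType) (n : nat).
Implicit Types p q : F.

Lemma toepTE p : toepT n p = toeplitz n (fun k => (qpoch p p k)^-1).
Proof. by []. Qed.

(** Multiplying by [1 - S] takes differences of consecutive coefficients. *)
Lemma toepT_subS p : (forall j, (0 < j < n)%N -> p ^+ j != 1) ->
  toepT n p *m (1%:M - shiftS F n)
    = toeplitz n (fun k => (qpoch p p k)^-1 * p ^+ k).
Proof.
move=> hp; rewrite mulmxBr mulmx1 -[shiftS F n]expr1 shiftS_exp.
rewrite toepTE toeplitzM.
transitivity (toeplitz n (fun k => (qpoch p p k)^-1 -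
    conv (fun k => (qpoch p p k)^-1) (fun l => (l == 1%N)%:R) k)).
  by apply/matrixP=> i j; rewrite !mxE; case: ifP; rewrite ?subr0.
apply: eq_toeplitz => -[|k] kn; rewrite /conv.
  by rewrite big_ord_recl big_ord0 /= mulr0 addr0 subr0 mulr1.
rewrite 2!big_ord_recl big1 /=; last by move=> i _; rewrite mulr0.
rewrite mulr0 add0r addr0 mulr1 subSS subn0 -(@qpoch_inv_rec _ p k) ?hp //.
by rewrite mulrBr mulr1 opprB addrC subrK.
Qed.

Lemma toepT_conj_diagD q p : p != 0 -> q != 0 ->
    (forall j, (0 < j < n)%N -> q ^+ j != 1) ->
  toepT n q *m (diagD n p^-1 *m toepT n q^-1 *m diagD n p)
    = toeplitz n (fun k => qpoch (p^-1 * q) q k / qpoch q q k).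
Proof.
move=> p0 q0 hq; rewrite !toepTE diagD_toeplitz // toeplitzM.
apply: eq_toeplitz => k kn; apply: qbinomial_conv => // j /andP[j0 jk].
by rewrite hq // j0 (leq_ltn_trans jk).
Qed.

Lemma toepT_diagD_sum q m : (0 < n)%N -> (0 < m)%N -> q != 0 ->
    (forall j, (0 < j < n)%N -> q ^+ j != 1) ->
  toepT n q *m (diagD n (q ^- m) *m toepT n q^-1 *m diagD n (q ^+ m))
    = 1%:M + \sum_(1 <= j < m | (j < n)%N)
        (qpoch (q ^ (1 - m%:Z)) q j / qpoch q q j) *: shiftS F n ^+ j.
Proof.
move=> n0 m0 q0 hq; rewrite toepT_conj_diagD ?expf_neq0 //.
have -> : q ^ (1 - m%:Z) = q ^- m * q.
  by rewrite expfzDr // expr1z -exprnN mulrC.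
apply: toeplitz_sum_cut => //; first by rewrite !qpoch0 divr1.
(* for k >= m, the factor of index m - 1 in (q^(1-m);q)_k is 1 - 1 *)
move=> k /andP[mk _]; rewrite (@qpoch_eq0 _ _ _ _ m.-1) ?mul0r ?prednK //.
by rewrite -mulrA -exprS prednK // mulVf ?expf_neq0.
Qed.

End QToeplitz.

Theorem theorem2 (R : realType) (n : nat) (q : complex R)
    (hn : (1 <= n)%N) (hq0 : q != 0)
    (hq : forall j : nat, (1 <= j <= n - 1)%N -> q ^+ j != 1) :
  [/\ toepT n q \in unitmx,
      invmx (toepT n q) = toepT n q^-1 *m (1%:M - shiftS _ n),
      toepT n q^-1 *m (1%:M - shiftS _ n)
        = diagD n q^-1 *m toepT n q^-1 *m diagD n q
    & forall m : nat, (1 <= m)%N ->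
      toepT n q *m diagD n (q ^- m) *m toepT n q^-1 *m diagD n (q ^+ m)
        = 1%:M + \sum_(1 <= j < m | (j < n)%N)
            (qpoch (q ^ (1 - m%:Z)) q j / qpoch q q j) *: shiftS _ n ^+ j].
Proof.
have hq' j : (0 < j < n)%N -> q ^+ j != 1.
  by move=> /andP[j0 jn]; rewrite hq // j0 subn1 -ltnS prednK.
have inv_eq : toepT n q^-1 *m (1%:M - shiftS _ n)
    = diagD n q^-1 *m toepT n q^-1 *m diagD n q.
  rewrite [in RHS]toepTE diagD_toeplitz // toepT_subS // => j jn.
  exact/expr_inv_neq1/hq'.
have TV : toepT n q *m (toepT n q^-1 *m (1%:M - shiftS _ n)) = 1%:M.
  rewrite inv_eq -[RHS]addr0; have := toepT_diagD_sum hn (ltn0Sn 0) hq0 hq'.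
  by rewrite big_geq // expr1.
have [Tunit _] := mulmx1_unit TV.
split=> // [|m m0]; first by rewrite -[RHS](mulKmx Tunit) TV mulmx1.
by rewrite -toepT_diagD_sum // !mulmxA.
Qed.
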